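(* For every graph $H$ we have $\operatorname{box}_\ell(H) = \overline{\operatorname{box}}_\ell(H) = \overline{\operatorname{box}}_f(H)$.
   Context: All graphs are finite and simple; $H^c$ denotes the complement of $H$. An interval graph is an intersection graph of intervals on the real line; a co-interval graph is the complement of an interval graph. $\mathcal{C}$ is the class of all co-interval graphs and $\overline{\mathcal{C}}$ is the class of all graphs that are vertex-disjoint unions of co-interval graphs. A graph homomorphism $\varphi: G\to H$ is a map $V(G)\to V(H)$ with $uv\in E(G)\Rightarrow \varphi(u)\varphi(v)\in E(H)$. For a graph class $\mathcal{G}$, a graph $H$ and a positive integer $t$, a $t$-global $\mathcal{G}$-cover of $H$ is an edge-surjective homomorphism $\varphi: G_1\sqcup\cdots\sqcup G_t\to H$ (vertex-disjoint union) with each $G_i\in\mathcal{G}$; it is injective if its restriction to each $G_i$ is injective, and $s$-local if $|\varphi^{-1}(v)|\le s$ for all $v\in V(H)$. The local covering number $c_\ell^{\mathcal{G}}(H)$ is the minimum $s$ such that an $s$-local injective $\mathcal{G}$-cover of $H$ exists (with any number $t$ of graphs); the folded covering number $c_f^{\mathcal{G}}(H)$ is the minimum $s$ such that a $1$-global $s$-local $\mathcal{G}$-cover of $H$ exists (minimum of the empty set is $\infty$). Define $\operatorname{box}_\ell(H):=c_\ell^{\mathcal{C}}(H^c)$, $\overline{\operatorname{box}}_\ell(H):=c_\ell^{\overline{\mathcal{C}}}(H^c)$, $\overline{\operatorname{box}}_f(H):=c_f^{\overline{\mathcal{C}}}(H^c)$. *)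

(* Defs.v *)
From HB Require Import structures.
From mathcomp Require Import all_boot all_order all_algebra.
From mathcomp Require Import boolp reals.

Set Implicit Arguments.
Unset Strict Implicit.
Unset Printing Implicit Defensive.

Record sgraph := SGraph {
  vertex :> finType;
  edge : rel vertex;
  edge_sym : symmetric edge;
  edge_irrefl : irreflexive edge
}.

Definition graph_iso (G H : sgraph) : Prop :=
  exists2 f : G -> H, bijective f & forall x y, edge (f x) (f y) = edge x y.

Definition graph_hom (G H : sgraph) (phi : G -> H) : Prop :=
  forall x y, edge x y -> edge (phi x) (phi y).

Section Complement.
Variable G : sgraph.

Definition compl_edge : rel G := [rel x y | (x != y) && ~~ edge x y].

Lemma compl_edge_sym : symmetric compl_edge.
Proof. by move=> x y; rewrite /compl_edge /= eq_sym edge_sym. Qed.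

Lemma compl_edge_irrefl : irreflexive compl_edge.
Proof. by move=> x; rewrite /compl_edge /= eqxx. Qed.

Definition compl : sgraph := SGraph compl_edge_sym compl_edge_irrefl.

End Complement.

Section DisjointUnion.
Variables (I : finType) (G : I -> sgraph).

(* [tagged_as u v] is the second component of [v] transported to the fibre of
   [u]; it is meaningful exactly when the two tags agree. *)
Definition dunion_edge : rel {i : I & G i} :=
  [rel u v | (tag u == tag v) && edge (tagged u) (tagged_as u v)].

Lemma dunion_edge_sym : symmetric dunion_edge.
Proof.
move=> [i x] [j y]; rewrite /dunion_edge /= eq_sym.
by case: eqVneq y => //= -> y; rewrite !tagged_asE edge_sym.
Qed.

Lemma dunion_edge_irrefl : irreflexive dunion_edge.
Proof. by move=> [i x]; rewrite /dunion_edge /= tagged_asE edge_irrefl andbF. Qed.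

Definition dunion : sgraph := SGraph dunion_edge_sym dunion_edge_irrefl.

End DisjointUnion.

(* Intervals are nonempty but otherwise arbitrary: open, closed, half-open,
   bounded or not. *)
Definition interval_graph (R : realType) (G : sgraph) : Prop :=
  exists J : G -> interval R,
    (forall x, exists r : R, r \in J x) /\
    (forall x y, x != y ->
       (edge x y <-> exists r : R, r \in J x /\ r \in J y)).

Definition co_interval (R : realType) (G : sgraph) : Prop :=
  exists2 I : sgraph, interval_graph R I & graph_iso G (compl I).

Definition union_co_interval (R : realType) (G : sgraph) : Prop :=
  exists (k : nat) (F : 'I_k -> sgraph),
    (forall i, co_interval R (F i)) /\ graph_iso G (dunion F).

Definition edge_surjective (G H : sgraph) (phi : G -> H) : Prop :=
  forall u v : H, edge u v ->
    exists x y : G, [/\ edge x y, phi x = u & phi y = v].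

Definition global_cover (C : sgraph -> Prop) (H : sgraph) (t : nat)
    (G : 'I_t -> sgraph) (phi : dunion G -> H) : Prop :=
  [/\ 0 < t, forall i, C (G i), graph_hom phi & edge_surjective phi].

Definition injective_cover (H : sgraph) (t : nat) (G : 'I_t -> sgraph)
    (phi : dunion G -> H) : Prop :=
  forall i : 'I_t, injective (fun x : G i => phi (Tagged G x)).

Definition local_cover (H : sgraph) (s t : nat) (G : 'I_t -> sgraph)
    (phi : dunion G -> H) : Prop :=
  forall v : H, #|[pred x | phi x == v]| <= s.

(* Minimum in N + {oo}: [None] is oo, the minimum of the empty set. *)
Definition min_nat (P : nat -> Prop) : option nat :=
  match pselect (exists n, `[< P n >]) with
  | left exP => Some (ex_minn exP)
  | right _ => None
  end.

Definition local_covering_number (C : sgraph -> Prop) (H : sgraph) :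
    option nat :=
  min_nat (fun s => exists (t : nat) (G : 'I_t -> sgraph) (phi : dunion G -> H),
    [/\ global_cover C phi, injective_cover phi & local_cover s phi]).

Definition folded_covering_number (C : sgraph -> Prop) (H : sgraph) :
    option nat :=
  min_nat (fun s => exists (G : 'I_1 -> sgraph) (phi : dunion G -> H),
    global_cover C phi /\ local_cover s phi).

Definition box_local (R : realType) (H : sgraph) : option nat :=
  local_covering_number (co_interval R) (compl H).

Definition union_box_local (R : realType) (H : sgraph) : option nat :=
  local_covering_number (union_co_interval R) (compl H).

Definition union_box_folded (R : realType) (H : sgraph) : option nat :=
  folded_covering_number (union_co_interval R) (compl H).

(* Main.v *)
(** Only the step from folded to local covers is not formal.  Let a disjoint
    union of co-interval graphs map homomorphically to [H], and fix a component,
    represented by intervals whose disjointness is adjacency.  Two vertices with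
    the same image are not adjacent, so their intervals meet; replace the
    vertices over [v] by one vertex carrying the intersection of their intervals.
    By Helly's theorem on the line this intersection is nonempty, and the
    intersections over [v] and [w] are disjoint only if already two of the
    original intervals are.  Hence the image of each component is again a
    co-interval graph. *)
Require Import Defs.
From mathcomp Require Import all_boot all_order all_algebra.
From mathcomp Require Import boolp reals.

Set Implicit Arguments.
Unset Strict Implicit.
Unset Printing Implicit Defensive.

Import Order.TTheory.

(** * Intervals on the line and co-interval graphs *)

Definition itv_meets (R : realType) (I J : interval R) : Prop :=
  exists r : R, r \in I /\ r \in J.

(* The interval with the largest lower bound meets the one with the smallest
   upper bound, and a common point of these two lies in every interval. *)
Lemma itv_helly (R : realType) (T : finType) (P : pred T)
    (J : T -> interval R) :
  (exists x, P x) ->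
  (forall x y, P x -> P y -> itv_meets (J x) (J y)) ->
  exists r : R, forall x, P x -> r \in J x.
Proof.
case=> x0 Px0 meetsJ.
pose lo x := let: Interval l _ := J x in l.
pose up x := let: Interval _ u := J x in u.
have memJ r x : (r \in J x) = (lo x <= BLeft r)%O && (BRight r <= up x)%O.
  by rewrite /lo /up; case: (J x) => l u; rewrite itv_boundlr.
case: (@arg_maxP _ _ _ x0 P lo Px0) => a Pa maxa.
case: (@arg_minP _ _ _ x0 P up Px0) => b Pb minb.
have [r [ra rb]] := meetsJ a b Pa Pb; exists r => x Px.
move: ra rb; rewrite !memJ => /andP[ra _] /andP[_ rb].
by rewrite (le_trans (maxa x Px) ra) (le_trans rb (minb x Px)).
Qed.

Lemma in_bigcap_itv (R : realType) (T : finType) (P : pred T)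
    (J : T -> interval R) (r : R) :
  r \in (\meet_(x | P x) J x)%O <-> forall x, P x -> r \in J x.
Proof.
have -> : (r \in (\meet_(x | P x) J x)%O) = \big[andb/true]_(x | P x) (r \in J x).
  by apply: (big_morph (fun I : interval R => r \in I)) => // I I'; rewrite in_itvI.
by rewrite big_all_cond; split=> [/allP rJ x Px|rJ];
  [have /implyP := rJ x (mem_index_enum x); apply
  |apply/allP => x _; apply/implyP; apply: rJ].
Qed.

(** Complement and isomorphism are absorbed into one representation in which adjacency is
    disjointness. Nonemptiness is implicit: irreflexivity of [edge] makes every [J x] meet
    itself. *)
Lemma co_intervalP (R : realType) (G : sgraph) :
  co_interval R G <->
  exists J : G -> interval R, forall x y, edge x y <-> ~ itv_meets (J x) (J y).
Proof.
split=> [[I [J [J0 JE]] [f /bij_inj finj fE]]|[J JE]].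
  exists (J \o f) => x y; rewrite -fE /= /compl_edge /=.
  have [fxy|nfxy] := eqVneq (f x) (f y); rewrite /=.
    by split=> // []; case; case: (J0 (f x)) => r rx; exists r; rewrite -fxy.
  by split=> [/negP nE /JE -/(_ nfxy)//|nm]; apply/negP => /JE -/(_ nfxy).
exists (compl G); last first.
  exists id => [|x y]; first by exists id.
  rewrite /= /compl_edge /= negb_and negbK /=.
  by case: eqVneq => [->|] /=; rewrite ?edge_irrefl ?negbK.
exists J; split=> [x|x y nxy].
  have /contrapT[r [rx _]] : ~ ~ itv_meets (J x) (J x).
    by move=> /JE; rewrite edge_irrefl.
  by exists r.
rewrite /= /compl_edge /= nxy /=; split=> [/negP nE|m].
  by apply: contrapT => nm; apply: nE; apply/JE.
by apply/negP => /JE.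
Qed.

(** * Labelled representations of disjoint unions *)

(* [c] labels the co-interval parts; a label class may be any union of
   components that is jointly represented by [J]. *)
Definition component_itv_repr (R : realType) (G : sgraph)
    (c : G -> nat) (J : G -> interval R) : Prop :=
  forall x y, edge x y <-> c x = c y /\ ~ itv_meets (J x) (J y).

Lemma dunion_edgeP (I : finType) (G : I -> sgraph) (i : I) (x y : G i) :
  edge (Tagged G x : dunion G) (Tagged G y) = edge x y.
Proof. by rewrite /= /dunion_edge /= eqxx tagged_asE. Qed.

Lemma dunion_edge_tag (I : finType) (G : I -> sgraph) (u v : dunion G) :
  edge u v -> tag u = tag v.
Proof. by case/andP=> /eqP. Qed.

Section Induced.
Variables (G : sgraph) (P : pred G).

Definition induced_edge : rel {x : G | P x} := [rel x y | edge (val x) (val y)].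

Lemma induced_edge_sym : symmetric induced_edge.
Proof. by move=> x y; apply: edge_sym. Qed.

Lemma induced_edge_irrefl : irreflexive induced_edge.
Proof. by move=> x; apply: edge_irrefl. Qed.

Definition induced : sgraph := SGraph induced_edge_sym induced_edge_irrefl.

End Induced.

Lemma union_co_intervalP (R : realType) (G : sgraph) :
  union_co_interval R G <->
  exists (c : G -> nat) (J : G -> interval R), component_itv_repr c J.
Proof.
split=> [[k [F [FC [f _ fE]]]]|[c [J cJ]]].
  have {}FC i := cid (proj1 (co_intervalP R (F i)) (FC i)).
  exists (fun x => tag (f x) : nat).
  exists (fun x => projT1 (FC (tag (f x))) (tagged (f x))) => x y.
  rewrite -fE; case: (f x) (f y) => [i u] [j v] /=.
  split=> [uv|[/val_inj ij]].
    have /= ij := dunion_edge_tag uv; case: j / ij v uv => v.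
    by rewrite [dunion_edge _ _]dunion_edgeP => /(projT2 (FC i)).
  by case: j / ij v => v /(projT2 (FC i)); rewrite [dunion_edge _ _]dunion_edgeP.
pose k := (\max_x c x).+1.
have ck x : c x < k by rewrite ltnS (leq_bigmax x).
pose F (i : 'I_k) := induced [pred x : G | c x == i].
exists k, F; split=> [i|].
  apply/co_intervalP; exists (fun x => J (val x)) => x y.
  split=> [/cJ[]//|nm]; apply/cJ; split=> //.
  by rewrite (eqP (valP x)) (eqP (valP y)).
pose in_part (i : 'I_k) x (cx : c x = i) : F i := Sub x (introT eqP cx).
pose f x : dunion F := Tagged F (@in_part (Ordinal (ck x)) x erefl).
(* Any index equal to the label may replace [Ordinal (ck x)], so two vertices with equal labels can
   be moved into literally the same fibre. *)
have fE (i : 'I_k) x (cx : c x = i) : f x = Tagged F (in_part i x cx).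
  have ei : Ordinal (ck x) = i by apply: val_inj.
  by case: i / ei cx => cx; congr Tagged; apply: val_inj.
exists f => [|x y].
  exists (fun u : dunion F => val (tagged u)) => // - [i [x px]] /=.
  by rewrite (fE i x (eqP px)); congr Tagged; apply: val_inj.
apply/idP/idP => [xy|/[dup] xy /cJ[cxy _]].
  have /(congr1 val)/= cxy := dunion_edge_tag xy.
  by move: xy; rewrite (fE (Ordinal (ck y)) x cxy) dunion_edgeP.
by rewrite (fE (Ordinal (ck y)) x cxy) dunion_edgeP.
Qed.

Lemma co_interval_union (R : realType) (G : sgraph) :
  co_interval R G -> union_co_interval R G.
Proof.
move=> /co_intervalP[J JE]; apply/union_co_intervalP; exists (fun=> 0), J.
by move=> x y; split=> [/JE//|[_ /JE]].
Qed.

Lemma union_co_interval_dunion (R : realType) (I : finType) (G : I -> sgraph) :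
  (forall i, union_co_interval R (G i)) -> union_co_interval R (dunion G).
Proof.
move=> GC; have {}GC i := cid (proj1 (union_co_intervalP R (G i)) (GC i)).
have JC i := cid (projT2 (GC i)).
apply/union_co_intervalP.
(* Pairing the old label with the index and encoding the pair injectively keeps labels from
   different [G i] apart. *)
exists (fun u : dunion G => pickle (tag u, projT1 (GC (tag u)) (tagged u))).
exists (fun u : dunion G => projT1 (JC (tag u)) (tagged u)).
move=> [i u] [j v]; split=> [uv|[/(pcan_inj pickleK)/= [ij]]].
  have /= ij := dunion_edge_tag uv; case: j / ij v uv => v /=.
  rewrite [dunion_edge _ _]dunion_edgeP => /(projT2 (JC i))[cE nm].
  by split=> //; congr (pickle (_, _)).
case: j / ij v => v /= cE nm.
by rewrite [dunion_edge _ _]dunion_edgeP; apply/(projT2 (JC i)).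
Qed.

(** * The image of one label class *)

Section PartImage.
Variables (D H : sgraph) (phi : D -> H) (phi_hom : graph_hom phi).
Variables (c : D -> nat) (i : nat).

Definition part_over (v : H) : pred D := [pred x | (c x == i) && (phi x == v)].

(** Only vertices with a nonempty fibre in class [i] are kept; otherwise the fibres of the resulting
    cover could grow. *)
Definition part_image_edge : rel {v : H | [exists x, part_over v x]} :=
  [rel v w | [exists x, exists y,
     [&& part_over (val v) x, part_over (val w) y & edge x y]]].

Lemma part_image_edge_sym : symmetric part_image_edge.
Proof.
suff E v w : part_image_edge v w -> part_image_edge w v.
  by move=> v w; apply/idP/idP; apply: E.
case/'exists_existsP=> x [y /and3P[xv yw xy]].
by apply/'exists_existsP; exists y, x; rewrite xv yw edge_sym.
Qed.

Lemma part_image_edge_irrefl : irreflexive part_image_edge.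
Proof.
move=> v; apply/negbTE/negP => /existsP[x /existsP[y /and3P[/andP[_ /eqP xv]]]].
by case/andP=> _ /eqP yv /phi_hom; rewrite xv yv edge_irrefl.
Qed.

Definition part_image : sgraph :=
  SGraph part_image_edge_sym part_image_edge_irrefl.

Lemma part_image_co_interval (R : realType) (J : D -> interval R) :
  component_itv_repr c J -> co_interval R part_image.
Proof.
move=> cJ; apply/co_intervalP.
exists (fun v => (\meet_(x | part_over (val v) x) J x)%O) => v w.
split=> [/existsP[x /existsP[y /and3P[xv yw /cJ[_ nm]]]]|nm].
  case=> r [/in_bigcap_itv rv /in_bigcap_itv rw]; apply: nm.
  by exists r; split; [apply: rv|apply: rw].
apply: contrapT => nE; apply: nm.
have nEdge x y : part_over (val v) x -> part_over (val w) y -> ~ edge x y.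
  move=> xv yw xy; apply: nE; apply/existsP; exists x; apply/existsP; exists y.
  by rewrite xv yw.
have same u x y : part_over u x -> part_over u y -> ~ edge x y.
  by case/andP=> _ /eqP xu /andP[_ /eqP yu] /phi_hom; rewrite xu yu edge_irrefl.
(* Helly is applied to both fibres at once: a point common to all these intervals lies in both
   intersections. *)
pose P x := part_over (val v) x || part_over (val w) x.
have [||r rP] := @itv_helly R D P J.
- by have /existsP[x xv] := valP v; exists x; rewrite /P xv.
- move=> x y Px Py; apply: contrapT => nm.
  have cP z : P z -> c z = i by case/orP=> /andP[/eqP].
  have xy : edge x y by apply/cJ; rewrite !cP.
  case/orP: Px Py => Px /orP[] Py.
  + exact: same Px Py xy.
  + exact: nEdge Px Py xy.
  + by apply: nEdge Py Px _; rewrite edge_sym.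
  + exact: same Px Py xy.
by exists r; split; apply/in_bigcap_itv => x xP; apply: rP; rewrite /P xP ?orbT.
Qed.

End PartImage.

(** * Passing between the three kinds of covers *)

Section Covers.
Variables (R : realType) (H : sgraph) (s : nat).

Definition has_local_cover (C : sgraph -> Prop) : Prop :=
  exists (t : nat) (G : 'I_t -> sgraph) (phi : dunion G -> H),
    [/\ global_cover C phi, injective_cover phi & local_cover s phi].

Definition has_folded_cover (C : sgraph -> Prop) : Prop :=
  exists (G : 'I_1 -> sgraph) (phi : dunion G -> H),
    global_cover C phi /\ local_cover s phi.

Lemma local_cover_union :
  has_local_cover (co_interval R) -> has_local_cover (union_co_interval R).
Proof.
case=> t [G [phi [[t0 GC hom surj] inj loc]]]; exists t, G, phi; split=> //.
by split=> // i; apply: co_interval_union.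
Qed.

(** The disjoint union of all covering graphs is again a union of co-interval graphs, so it serves
    as the single graph of a folded cover with the same map. *)
Lemma folded_cover_of_local :
  has_local_cover (union_co_interval R) -> has_folded_cover (union_co_interval R).
Proof.
case=> t [G [phi [[t0 GC hom surj] _ loc]]].
pose G1 (_ : 'I_1) := dunion G.
have tag1 (u : dunion G1) : u = Tagged G1 (tagged u : G1 ord0).
  by case: u => i u; case: i / (esym (ord1 i)) u.
exists G1, (fun u => phi (tagged u)); split; first split=> //.
- by move=> i; apply: union_co_interval_dunion.
- by move=> u v; rewrite (tag1 u) (tag1 v) dunion_edgeP => /hom.
- move=> u v /surj[x [y [xy <- <-]]].
  exists (Tagged G1 (x : G1 ord0)), (Tagged G1 (y : G1 ord0)).
  by rewrite dunion_edgeP.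
- move=> v; apply: leq_trans (loc v).
  rewrite -(card_in_image (f := fun u : dunion G1 => tagged u : dunion G)).
    by apply/subset_leq_card/subsetP => _ /imageP[u uv ->].
  by move=> x y _ _ xy; rewrite (tag1 x) (tag1 y) xy.
Qed.

Lemma local_cover_of_folded :
  has_folded_cover (union_co_interval R) -> has_local_cover (co_interval R).
Proof.
case=> G [phi [[_ GC hom surj] loc]].
have /union_co_intervalP[c [J cJ]] := union_co_interval_dunion GC.
pose t := (\max_u c u).+1.
have ct u : c u < t by rewrite ltnS (leq_bigmax u).
(* Each label class contributes its image as a separate graph; the covering map becomes the
   inclusion into [H], injective on each graph. *)
pose F (i : 'I_t) := part_image hom c i.
exists t, F, (fun u : dunion F => val (tagged u)); split; first split=> //.
- by move=> i; apply: part_image_co_interval cJ.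
- move=> [i u] [j v] uv; have /= ij := dunion_edge_tag uv.
  case: j / ij v uv => v; rewrite dunion_edgeP.
  case/existsP=> x /existsP[y /and3P[/andP[_ /eqP <-]]].
  by case/andP=> _ /eqP <- /hom.
- move=> u v /surj[x [y [xy xu yv]]].
  have [cxy _] := proj1 (cJ x y) xy.
  pose i := Ordinal (ct x).
  have xi : part_over phi c i u x by rewrite /part_over /= xu !eqxx.
  have yi : part_over phi c i v y by rewrite /part_over /= yv -cxy !eqxx.
  have ui : [exists x, part_over phi c i u x] by apply/existsP; exists x.
  have vi : [exists x, part_over phi c i v x] by apply/existsP; exists y.
  exists (Tagged F (Sub u ui : F i)), (Tagged F (Sub v vi : F i)).
  split=> //; rewrite dunion_edgeP; apply/existsP; exists x; apply/existsP.
  by exists y; rewrite xi yi.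
- by move=> i x y /val_inj.
move=> v; apply: leq_trans (loc v).
(* Each new vertex over [v] chooses an old vertex over [v] in its own class. The choice determines
   the class, hence the new vertex, so fibres do not grow. *)
have pre (u : dunion F) := existsP (valP (tagged u)).
pose f u := xchoose (pre u).
have fP (u : dunion F) : part_over phi c (tag u) (val (tagged u)) (f u).
  exact: xchooseP (pre u).
rewrite -(card_in_image (f := f)).
  apply/subset_leq_card/subsetP => _ /imageP[u /eqP uv ->].
  by have /andP[_] := fP u; rewrite uv.
move=> x y /eqP xv /eqP yv fxy.
have /andP[/eqP cx _] := fP x; have /andP[/eqP cy _] := fP y.
have /val_inj : tag x = tag y :> nat by rewrite -cx -cy fxy.
case: x y xv yv {fxy cx cy} => [i x] [j y] /= xv yv ij.
by case: j / ij y yv => y yv; congr Tagged; apply: val_inj; exact: etrans xv (esym yv).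
Qed.

End Covers.

Theorem theorem3 (R : realType) (H : sgraph) :
  box_local R H = union_box_local R H /\
  union_box_local R H = union_box_folded R H.
Proof.
(* For each fixed [s] the three existence statements imply one another in a cycle, so the minima are
   taken over the same predicate. *)
split; congr min_nat; apply/funext => s; apply/propext; split.
- exact: local_cover_union.
- by move/folded_cover_of_local/local_cover_of_folded.
- exact: folded_cover_of_local.
- by move/local_cover_of_folded/local_cover_union.
Qed.
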